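(* In the single energy arrival problem, the temperature $T(t)$, $t\in[0,D]$, resulting from the optimal power policy is monotone increasing (i.e., non-decreasing) and concave.
   Context: Single energy arrival problem: fix a deadline $D>0$, an available energy $E>0$, constants $a,b>0$, an environment temperature $T_e$ and a critical temperature $T_c>T_e$; set $T_\delta=T_c-T_e$. A power policy is a measurable function $P:[0,D]\to[0,\infty)$. The resulting temperature $T(t)$ solves $\frac{d}{dt}T(t)=aP(t)-b(T(t)-T_e)$, $T(0)=T_e$, i.e. $T(t)=T_e+e^{-bt}\int_0^t ae^{b\tau}P(\tau)\,d\tau$. The optimal policy is the maximizer (unique almost everywhere) of $\int_0^D\frac12\log_2(1+P(\tau))\,d\tau$ over power policies satisfying $T(t)\le T_c$ for all $t\in[0,D]$ and $\int_0^DP(\tau)\,d\tau\le E$. *)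

(* Defs.v *)
From HB Require Import structures.
From mathcomp Require Import all_boot all_order all_algebra.
From mathcomp Require Import all_classical all_reals all_analysis.
Set Implicit Arguments.
Unset Strict Implicit.
Unset Printing Implicit Defensive.
Import Order.TTheory GRing.Theory Num.Theory.
Import numFieldNormedType.Exports.
Local Open Scope classical_set_scope.
Local Open Scope ring_scope.

(* Functions on [0, D] are total functions R -> R of which only the values on
   [0, D] are ever constrained or used. *)
Definition power_policy (R : realType) (D : R) (P : R -> R) : Prop :=
  measurable_fun `[0, D] P /\ (forall t, t \in `[0, D] -> 0 <= P t).

(* Integrals of nonnegative functions are kept extended-real valued, so that a
   policy of infinite energy has energy +oo and is never feasible. *)
Definition energy (R : realType) (D : R) (P : R -> R) : \bar R :=
  (\int[lebesgue_measure]_(t in `[0%R, D]) (P t)%:E)%E.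

Definition throughput (R : realType) (D : R) (P : R -> R) : \bar R :=
  (\int[lebesgue_measure]_(t in `[0%R, D])
     (2^-1 * (ln (1 + P t) / ln 2))%:E)%E.

(* The solution of T' = a P - b (T - Te), T 0 = Te. The real-valued integral is
   only meaningful when P is integrable, which finite energy guarantees. *)
Definition temperature (R : realType) (a b Te : R) (P : R -> R) (t : R) : R :=
  Te + expR (- (b * t)) *
    \int[lebesgue_measure]_(u in `[0, t]) (a * expR (b * u) * P u).

Definition feasible (R : realType) (D E a b Te Tc : R) (P : R -> R) : Prop :=
  [/\ power_policy D P,
      (forall t, t \in `[0, D] -> temperature a b Te P t <= Tc) &
      (energy D P <= E%:E)%E].

Definition optimal_policy (R : realType) (D E a b Te Tc : R) (P : R -> R)
    : Prop :=
  feasible D E a b Te Tc P /\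
  (forall Q, feasible D E a b Te Tc Q ->
     (throughput D Q <= throughput D P)%E).

Definition concave_on (R : realType) (A : set R) (f : R -> R) : Prop :=
  @convex_function R R^o A (\- f).

(* Main.v *)
Require Import Defs.
From HB Require Import structures.
From mathcomp Require Import all_boot all_order all_algebra.
From mathcomp Require Import all_classical all_reals all_analysis.
From mathcomp Require Import measurable_realfun ring lra.
Import Order.TTheory GRing.Theory Num.Theory.
Import numFieldNormedType.Exports.
Local Open Scope classical_set_scope.
Local Open Scope ring_scope.

(* Let [S = T - Te]. A constant power makes [S] an affine function of
   [exp (- b t)]. Spreading the energy spent on a subinterval [s, t] evenly over
   it strictly increases the throughput unless the power was already constant
   there, since [ln] is strictly concave; so for an optimal policy this operation
   is either infeasible or trivial.

   If [S] lay strictly below a chord (affine in [exp (- b t)]), take a maximal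
   interval where it is below the chord: it spends no more energy there than the
   chord does, so spreading that energy ends at a temperature no higher than [S],
   is feasible, and hence trivial, which is absurd. So [S] is concave as a function
   of [- exp (- b t)]. If [S] had a maximum point [r < D] with [S D < S r], holding
   [S r] after [r] would cost more energy than is spent, so spreading the energy
   over [s, D] with [s] slightly before [r] keeps [S] below [S r], is feasible, and
   makes [S] monotone on [s, D], again absurd. Thus [S] is nondecreasing, and
   concavity in the concave increasing function [- exp (- b t)] of [t] gives
   concavity in [t]. *)

(** * Elementary real analysis: telescoping, sign changes, a Taylor bound *)

(** Cutting [[s, t]] into [n.+1] equal pieces and telescoping bounds [f t - f s] by
    [K * (t - s) ^+ 2 / n.+1%:R], which tends to 0. This replaces a derivative test: the temperature
    under a merely measurable power need not be differentiable. *)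
Lemma nonincreasing_of_quadratic_increments (R : realType) (f : R -> R) (K s t : R) :
  s <= t ->
  (forall u v, s <= u -> u <= v -> v <= t -> f v - f u <= K * (v - u) ^+ 2) ->
  f t <= f s.
Proof.
move=> st fK.
have tel (n k : nat) : (k <= n.+1)%N ->
    f (s + k%:R * ((t - s) / n.+1%:R)) - f s
      <= k%:R * (K * ((t - s) / n.+1%:R) ^+ 2).
  elim: k => [_|k IH kn]; first by rewrite !mul0r addr0 subrr.
  have d0 : 0 <= (t - s) / n.+1%:R by rewrite divr_ge0// subr_ge0.
  have dE : n.+1%:R * ((t - s) / n.+1%:R) = t - s :> R.
    by rewrite mulrCA divff ?mulr1.
  move: d0 dE IH; set d := (t - s) / _ => d0 dE IH.
  have kn' : k.+1%:R * d <= n.+1%:R * d by rewrite ler_wpM2r// ler_nat.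
  have k0 : 0 <= k%:R * d by rewrite mulr_ge0.
  have kS : k.+1%:R = k%:R + 1 :> R by rewrite -natr1.
  have := fK (s + k%:R * d) (s + k.+1%:R * d).
  have := IH (ltnW kn); rewrite !kS in kn' *.
  have -> : s + (k%:R + 1) * d - (s + k%:R * d) = d by ring.
  have h1 : s <= s + k%:R * d by lra.
  have h2 : s + k%:R * d <= s + (k%:R + 1) * d by lra.
  have h3 : s + (k%:R + 1) * d <= t by lra.
  move=> IHk /(_ h1 h2 h3); lra.
rewrite leNgt; apply/negP => ft.
have e0 : 0 < f t - f s by lra.
have Kn (n : nat) : (f t - f s) * n.+1%:R <= K * (t - s) ^+ 2.
  have := tel n n.+1 (leqnn _).
  rewrite mulrCA divff// mulr1 subrKC => h.
  rewrite -ler_pdivlMr//; apply: (le_trans h).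
  by rewrite le_eqVlt; apply/orP; left; apply/eqP; field; rewrite -[X in X != 0]/(1 + n%:R) nat1r pnatr_eq0.
have [n hn] : exists n : nat, K * (t - s) ^+ 2 / (f t - f s) < n%:R.
  exists (Num.bound `|K * (t - s) ^+ 2 / (f t - f s)|).
  exact: le_lt_trans (ler_norm _) (archi_boundP (normr_ge0 _)).
have := Kn n; rewrite leNgt => /negP; apply.
rewrite ltr_pdivrMr// in hn; apply: (lt_le_trans hn).
by rewrite mulrC ler_wpM2l ?ltW// ltr_nat.
Qed.

(** [r] is the supremum of the points of [[s, m]] where [0 <= g]; continuity gives [0 <= g r], and
    the intermediate value theorem excludes [0 < g r]. *)
Lemma last_zero_before (R : realType) (g : R -> R) (s m : R) :
  s <= m -> {within `[s, m], continuous g} -> 0 <= g s -> g m < 0 ->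
  exists r, [/\ s <= r < m, g r = 0 &
    forall x, r < x -> x <= m -> g x < 0].
Proof.
move=> sm cg gs gm.
pose A := [set x | s <= x <= m /\ 0 <= g x].
have As : A s by split; rewrite ?lexx.
have ubA : ubound A m by move=> x [/andP[]].
have supA : has_sup A by split; [exists s | exists m].
have [r [rub radh]] : exists r, ubound A r /\
    forall d, 0 < d -> exists2 x, A x & r - d < x.
  exists (sup A); split; first by move=> x; apply: ub_le_sup; exists m.
  by move=> d d0; exact: sup_adherent.
have sr : s <= r by exact: rub.
have rm : r <= m.
  rewrite leNgt; apply/negP => mr.
  have [|x /ubA] := radh (r - m); first by rewrite subr_gt0.
  lra.
have gr_neg x : r < x -> x <= m -> g x < 0.
  move=> rx xm; rewrite ltNge; apply/negP => gx.
  have : x <= r by apply: rub; split=> //; rewrite xm (le_trans sr (ltW rx)).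
  by rewrite leNgt rx.
have gr0 : 0 <= g r.
  rewrite leNgt; apply/negP => gr.
  have /subspace_continuousP /(_ r) := cg.
  have /[swap]/[apply] : `[s, m]%classic r by rewrite /= in_itv/= sr rm.
  move=> /cvgrPdist_lt /(_ (- g r)); rewrite oppr_gt0 => /(_ gr).
  rewrite /prop_near1 /within /= => -[d /= d0 hd].
  have [x Ax xr] := radh _ d0.
  have [/andP[sx xm] gx] := Ax.
  have xr' := rub _ Ax.
  have := hd x; rewrite /= in_itv/= sx xm.
  rewrite ger0_norm ?subr_ge0// => /(_ _ isT).
  have dx : r - x < d by rewrite ltrBlDr -ltrBlDl.
  move=> /(_ dx); rewrite distrC => /ltr_normlW.
  by rewrite ltrBlDr addNr ltNge gx.
have rm' : r < m.
  by rewrite lt_neqAle rm andbT; apply: contraTneq gm => <-; rewrite -leNgt.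
exists r; split=> //; first by rewrite sr.
apply/eqP; rewrite eq_le gr0 andbT leNgt; apply/negP => gr.
have cg' : {within `[r, m], continuous g}.
  by apply: continuous_subspaceW cg; apply: subset_itvr; rewrite bnd_simp.
have [|c] := @IVT _ g r m 0 rm cg'.
  by rewrite ge_min le_max (ltW gm) (ltW gr) orbT.
rewrite in_itv/= => /andP[rc cm] gc0.
have [rc'|] := ltP r c; first by have := gr_neg c rc' cm; rewrite gc0 ltxx.
move=> cr; have rE : c = r by apply/eqP; rewrite eq_le cr rc.
by move: gr; rewrite -rE gc0 ltxx.
Qed.

(** Reflecting [u] to [- u] reduces this to [last_zero_before]. *)
Lemma first_zero_after (R : realType) (g : R -> R) (m t : R) :
  m <= t -> {within `[m, t], continuous g} -> g m < 0 -> 0 <= g t ->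
  exists r, [/\ m < r <= t, g r = 0 &
    forall x, m <= x -> x < r -> g x < 0].
Proof.
move=> mt cg gm gt.
have tm : - t <= - m by rewrite lerN2.
have cgN : {within `[- t, - m], continuous g \o -%R}.
  by apply: within_continuous_compN; rewrite !opprK.
have gNt : 0 <= (g \o -%R) (- t) by rewrite /= opprK.
have gNm : (g \o -%R) (- m) < 0 by rewrite /= opprK.
have [r [/andP[tr rm] gr hr]] := @last_zero_before R _ _ _ tm cgN gNt gNm.
exists (- r); split=> //; first by apply/andP; split; lra.
move=> x mx xr; have := hr (- x); rewrite /= opprK; apply; lra.
Qed.

(** Using [expR x - 1 <= x * expR x] twice bounds the left side by [x ^+ 2 * expR x]. *)
Lemma expR_le_taylor1 (R : realType) (x y : R) : 0 <= x -> x <= y ->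
  expR x - 1 - x <= expR y * x ^+ 2.
Proof.
move=> x0 xy.
have e1 : 1 - x <= expR (- x) by have := @expR_ge1Dx R (- x); lra.
have ee := @expRxMexpNx_1 R x.
have e0 := @expR_gt0 R x.
have exy : expR x <= expR y by rewrite ler_expR.
have h : (1 - x) * expR x <= 1.
  by rewrite -[leRHS]ee mulrC ler_wpM2l ?expR_ge0.
have : expR x * x ^+ 2 <= expR y * x ^+ 2 by rewrite ler_wpM2r// sqr_ge0.
nra.
Qed.

(* A function [alpha + beta * exp (- b t)] is the temperature produced by the
   constant power [b * alpha / a]. *)
Lemma energy_le_of_below_chord (R : realType) (a b alpha beta s t : R)
    (S F : R -> R) :
  0 < b -> s <= t ->
  (forall u v, s <= u -> u <= v -> v <= t ->
    a * (F v - F u) <= expR (b * (v - u)) * S v - S u) ->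
  (forall u, s <= u -> u <= t -> S u <= alpha + beta * expR (- (b * u))) ->
  a * (F t - F s) <= (S t - (alpha + beta * expR (- (b * t))))
    - (S s - (alpha + beta * expR (- (b * s)))) + b * alpha * (t - s).
Proof.
move=> b0 st SF Sl.
pose g u := S u - (alpha + beta * expR (- (b * u))).
pose f u := a * F u - g u - b * alpha * u.
suff : f t <= f s by rewrite /f /g; lra.
(* The constant is uniform in [u] and [v]: it comes from the Taylor bound of the exponential on
   [[0, b * (t - s)]]. *)
apply: (@nonincreasing_of_quadratic_increments _ _
  (`|alpha| * (expR (b * (t - s)) * b ^+ 2))) => // u v su uv vt.
have gv : g v <= 0 by rewrite subr_le0 Sl// (le_trans su).
have bh0 : 0 <= b * (v - u) by rewrite mulr_ge0 ?subr_ge0// ltW.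
have bh1 : b * (v - u) <= b * (t - s) by rewrite ler_pM2l//; lra.
have ge1 : 1 <= expR (b * (v - u)) by rewrite -expR0 ler_expR.
have taylor := @expR_le_taylor1 R _ _ bh0 bh1.
have taylor0 : 0 <= expR (b * (v - u)) - 1 - b * (v - u).
  by have := @expR_ge1Dx R (b * (v - u)); lra.
have betaE : expR (b * (v - u)) * expR (- (b * v)) = expR (- (b * u)).
  by rewrite -expRD; congr expR; ring.
have SFuv := SF u v su uv vt.
(* The [beta] term cancels because it decays exactly like free cooling; only the level [alpha] costs
   energy. *)
have gE : expR (b * (v - u)) * S v - S u =
    expR (b * (v - u)) * g v - g u + alpha * (expR (b * (v - u)) - 1).
  by rewrite /g -betaE; ring.
(* As [g v <= 0], dropping a factor at least 1 can only enlarge the product. *)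
have gv1 : expR (b * (v - u)) * g v <= g v.
  have : (expR (b * (v - u)) - 1) * g v <= 0.
    by apply: mulr_ge0_le0 => //; rewrite subr_ge0.
  lra.
have absle : alpha * (expR (b * (v - u)) - 1 - b * (v - u)) <=
    `|alpha| * (expR (b * (t - s)) * (b * (v - u)) ^+ 2).
  apply: le_trans (_ : `|alpha| * (expR (b * (v - u)) - 1 - b * (v - u)) <= _).
    by rewrite ler_wpM2r// ler_norm.
  by rewrite ler_wpM2l.
have -> : `|alpha| * (expR (b * (t - s)) * b ^+ 2) * (v - u) ^+ 2 =
    `|alpha| * (expR (b * (t - s)) * (b * (v - u)) ^+ 2) by ring.
rewrite /f; lra.
Qed.

(** * Shape of a curve that is rigid under averaging *)

(* [S] is the temperature rise, [F t] the energy spent until [t] and [M] the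
   largest admissible rise. [U] is the rise on [s, t] once the energy spent there
   is spread evenly; the two hypotheses on [U t] make this feasible on [s, t] and
   after [t] respectively. *)
Record rigid_under_averaging (R : realType) (a b D M : R) (S F : R -> R) : Prop :=
  {
  rigid_start : S 0 = 0;
  rigid_ge0 : forall t, 0 <= t -> t <= D -> 0 <= S t;
  rigid_le : forall t, 0 <= t -> t <= D -> S t <= M;
  rigid_contS : {within `[0, D], continuous S};
  rigid_contF : {within `[0, D], continuous F};
  rigid_gain : forall s t, 0 <= s -> s <= t -> t <= D ->
    a * (F t - F s) <= expR (b * (t - s)) * S t - S s;
  rigid_average : forall s t, 0 <= s -> s < t -> t <= D ->
    let c := a * ((F t - F s) / (t - s)) / b in
    let U x := c + (S s - c) * expR (- (b * (x - s))) in
    U t <= M -> t = D \/ U t <= S t ->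
    forall x, s <= x -> x <= t -> S x = U x }.

Arguments rigid_start {R a b D M S F}.
Arguments rigid_ge0 {R a b D M S F}.
Arguments rigid_le {R a b D M S F}.
Arguments rigid_contS {R a b D M S F}.
Arguments rigid_contF {R a b D M S F}.
Arguments rigid_gain {R a b D M S F}.
Arguments rigid_average {R a b D M S F}.

Section RigidShape.
Context (R : realType) (a b D M : R) (S F : R -> R).
Context (b0 : 0 < b) (D0 : 0 < D).
Context (SF : rigid_under_averaging R a b D M S F).

(** With equality at both ends this is concavity in [- expR (- (b * u))]; allowing inequalities
    there lets [beta = 0] yield monotonicity too. *)
Lemma rigid_above_chord (alpha beta s m t : R) :
  0 <= s -> s <= m -> m <= t -> t <= D ->
  alpha + beta * expR (- (b * s)) <= S s ->
  alpha + beta * expR (- (b * t)) <= S t ->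
  alpha + beta * expR (- (b * m)) <= S m.
Proof.
move=> s0 sm mt tD Ss St; rewrite leNgt; apply/negP => Sm.
pose l u := alpha + beta * expR (- (b * u)).
have cl : continuous l.
  move=> x; apply: cvgD; first exact: cvg_cst.
  apply: cvgM; first exact: cvg_cst.
  apply: continuous_comp; last exact: continuous_expR.
  by apply: cvgN; apply: cvgM; [exact: cvg_cst|exact: cvg_id].
pose g : R -> R := S - l.
have gE u : g u = S u - l u by [].
have cg : {within `[0, D], continuous g}.
  apply: within_continuousB; first exact: (rigid_contS SF).
  exact: continuous_subspaceT.
have cgs : {within `[s, m], continuous g}.
  by apply: continuous_subspaceW cg; apply: subset_itv; rewrite bnd_simp//; lra.
have cgt : {within `[m, t], continuous g}.
  by apply: continuous_subspaceW cg; apply: subset_itv; rewrite bnd_simp//; lra.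
have gm : g m < 0 by rewrite gE subr_lt0.
have gs : 0 <= g s by rewrite gE subr_ge0.
have gt : 0 <= g t by rewrite gE subr_ge0.
(* [[r, q]] is the maximal interval around [m] on which [S] is below [l]; the two curves meet at its
   ends. *)
have [r [/andP[sr rm] gr rneg]] := last_zero_before _ _ _ _ sm cgs gs gm.
have [q [/andP[mq qt] gq qneg]] := first_zero_after _ _ _ _ mt cgt gm gt.
have rq : r < q by lra.
have r0 : 0 <= r by lra.
have qD : q <= D by lra.
have Sr : S r = l r by apply/eqP; rewrite -subr_eq0 -gE gr.
have Sq : S q = l q by apply/eqP; rewrite -subr_eq0 -gE gq.
have below u : r <= u -> u <= q -> S u <= l u.
  move=> ru uq; rewrite -subr_le0 -gE.
  have [->|ur] := eqVneq u r; first by rewrite gr.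
  have [->|uq'] := eqVneq u q; first by rewrite gq.
  have [um|mu] := leP u m.
    by apply/ltW/rneg => //; rewrite lt_neqAle eq_sym ur.
  by apply/ltW/qneg; [exact: ltW|rewrite lt_neqAle uq'].
have energy := energy_le_of_below_chord R a b alpha beta r q S F b0 (ltW rq).
have {}energy : a * (F q - F r) <= b * alpha * (q - r).
  have := energy (fun u v ru uv vq => rigid_gain SF u v (le_trans r0 ru) uv (le_trans vq qD)) below.
  by rewrite -/(l q) -/(l r) Sr Sq !subrr add0r.
(* [c] is the equilibrium rise under the average power, as [alpha] is for the chord; spending no
   more energy than the chord means [c <= alpha]. *)
pose c := a * ((F q - F r) / (q - r)) / b.
have qr0 : 0 < q - r by rewrite subr_gt0.
have cE : c * (b * (q - r)) = a * (F q - F r).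
  by rewrite /c; field; rewrite !gt_eqF.
have calpha : c <= alpha.
  have p0 : 0 < b * (q - r) by rewrite mulr_gt0.
  by rewrite -(ler_pM2r p0) cE; lra.
have lrE u : l u = alpha + (l r - alpha) * expR (- (b * (u - r))).
  rewrite /l addrAC subrr add0r -mulrA -expRD; congr (_ + _ * expR _); ring.
have e1 u : r < u -> expR (- (b * (u - r))) < 1.
  by move=> ru; rewrite expR_lt1 oppr_lt0 mulr_gt0// subr_gt0.
(* Both curves start from [S r] at [r], so only their equilibria separate them. *)
have UE u : c + (S r - c) * expR (- (b * (u - r)))
    = l u - (alpha - c) * (1 - expR (- (b * (u - r)))).
  by rewrite (lrE u) Sr; ring.
have Uq : c + (S r - c) * expR (- (b * (q - r))) <= S q.
  rewrite UE Sq; have := e1 _ rq; nra.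
have avg := rigid_average SF r q r0 rq qD.
have {}avg := avg (le_trans Uq (rigid_le SF q (ltW (le_lt_trans r0 rq)) qD)) (or_intror Uq).
(* Equality at [q] forces [c = alpha], which puts [S m] on the chord, against [Sm]. *)
have := avg q (ltW rq) (lexx _); rewrite -/c UE Sq => /eqP.
rewrite eq_sym subr_eq -subr_eq0 opprD addNKr oppr_eq0 mulf_eq0 !subr_eq0.
rewrite [_ == expR _]gt_eqF ?e1// orbF => /eqP ac.
have := avg m (ltW rm) (ltW mq); rewrite -/c UE ac subrr mul0r subr0.
by move=> SmE; move: Sm; rewrite SmE ltxx.
Qed.

Lemma rigid_max_at_end (t : R) : 0 <= t -> t <= D -> S t <= S D.
Proof.
have [r rD rmax] := EVT_max (ltW D0) (rigid_contS SF).
move: rD; rewrite in_itv/= => /andP[r0 rD].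
suff SrD : S r <= S D.
  by move=> t0 tD; apply: le_trans SrD; apply: rmax; rewrite in_itv/= t0.
rewrite leNgt; apply/negP => SDr.
have rD' : r < D.
  by rewrite lt_neqAle rD andbT; apply: contraTneq SDr => ->; rewrite ltxx.
have max u : 0 <= u -> u <= D -> S u <= S r.
  by move=> u0 uD; apply: rmax; rewrite in_itv/= u0.
have r0' : 0 < r.
  rewrite lt_neqAle r0 andbT; apply: contraTneq SDr => <-.
  by rewrite (rigid_start SF) -leNgt (rigid_ge0 SF)// ltW.
pose k u := a * F u - b * S r * u - (a * F D - b * S r * D).
have kr : 0 < k r.
  have gain u v (ru : r <= u) uv vD := rigid_gain SF u v (le_trans r0 ru) uv vD.
  have below u : r <= u -> u <= D -> S u <= S r + 0 * expR (- (b * u)).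
    by move=> ru uD; rewrite mul0r addr0 max// (le_trans r0).
  have := energy_le_of_below_chord R a b _ _ r D S F b0 rD gain below.
  rewrite !mul0r !addr0 /k; lra.
(* Either [s = 0] works or [k] has a zero before [r]. Then [0 <= k s] says that the average power on
   [[s, D]] has equilibrium at most [S r]. *)
have [s [s0 sr ks]] : exists s, [/\ 0 <= s, s < r & 0 <= k s].
  have [k0|k0] := leP 0 (k 0); first by exists 0.
  have ck : {within `[0, r], continuous k}.
    have cF : {within `[0, r], continuous F}.
      apply: continuous_subspaceW (rigid_contF SF).
      by apply: subset_itv; rewrite bnd_simp.
    move=> x; apply: cvgB; last exact: cvg_cst.
    apply: cvgB; first by apply: cvgM; [exact: cvg_cst|exact: cF].
    have c1 : {within `[0, r], continuous (fun u : R => b * S r * u)}.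
      apply: continuous_subspaceT => u.
      by apply: cvgM; [exact: cvg_cst|exact: cvg_id].
    exact: c1.
  have [|s] := @IVT R k 0 r 0 r0 ck.
    by rewrite ge_min le_max (ltW k0) (ltW kr) orbT.
  rewrite in_itv/= => /andP[s0 sr] ks; exists s; split; rewrite ?ks//.
  by rewrite lt_neqAle sr andbT; apply: contraTneq kr => <-; rewrite ks ltxx.
pose c := a * ((F D - F s) / (D - s)) / b.
have Ds0 : 0 < D - s by lra.
have cE : c * (b * (D - s)) = a * (F D - F s).
  by rewrite /c; field; rewrite !gt_eqF.
have cSr : c <= S r.
  have p0 : 0 < b * (D - s) by rewrite mulr_gt0.
  rewrite -(ler_pM2r p0) cE; move: ks; rewrite /k; lra.
have Ssr : S s <= S r by apply: max => //; lra.
pose U x := c + (S s - c) * expR (- (b * (x - s))).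
have e1 u : s < u -> expR (- (b * (u - s))) < 1.
  by move=> ru; rewrite expR_lt1 oppr_lt0 mulr_gt0// subr_gt0.
have e0 u : 0 < expR (- (b * (u - s))) by exact: expR_gt0.
have sD : s < D by lra.
(* [U D] is a convex combination of [c] and [S s], both at most [S r]. *)
have UD : U D <= M.
  apply: le_trans (rigid_le SF r r0 rD).
  rewrite /U; have := e1 _ sD; have := e0 D; nra.
have avg := rigid_average SF s D s0 sD (lexx _) UD (or_introl erefl).
have SrE : S r = U r by apply: avg => //; exact: ltW.
have SDE : S D = U D by apply: avg => //; exact: ltW.
have e1r := e1 _ sr; have e0r := e0 r.
have e1D := e1 _ sD; have e0D := e0 D.
(* Both weights in [U r] are positive, so [S r = U r] forces [c = S s = S r]; then [U] is constant
   and [S D = S r], a contradiction. *)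
have cr : c = S r.
  apply/eqP; rewrite eq_le cSr /= leNgt; apply/negP => cltr.
  move: SrE; rewrite /U; nra.
have Ssc : S s = c.
  move: SrE; rewrite /U -cr -[LHS]addr0 => /addrI /esym/eqP.
  by rewrite mulf_eq0 [expR _ == 0]gt_eqF// orbF subr_eq0 => /eqP.
by move: SDr; rewrite SDE /U Ssc subrr mul0r addr0 cr ltxx.
Qed.

(** A horizontal chord at height [S s] on [[s, D]] suffices, since [rigid_max_at_end] puts its right
    end below [S D]. *)
Lemma rigid_nondecreasing (s t : R) : 0 <= s -> s <= t -> t <= D -> S s <= S t.
Proof.
move=> s0 st tD; have := rigid_above_chord (S s) 0 s t D s0 st tD (lexx _).
rewrite !mul0r addr0; apply => //.
exact: rigid_max_at_end (le_trans st tD).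
Qed.

(** The chord in the variable [x u = expR (- (b * u))] has slope [beta <= 0] by monotonicity, and
    [x] is convex in time, so this chord lies above the straight one. *)
Lemma rigid_concave (s t p : R) : 0 <= s -> s <= t -> t <= D ->
  0 <= p -> p <= 1 -> p * S s + (1 - p) * S t <= S (p * s + (1 - p) * t).
Proof.
move=> s0 st tD p0 p1.
have [<-|nst] := eqVneq s t.
  have -> : p * s + (1 - p) * s = s by ring.
  by have -> : p * S s + (1 - p) * S s = S s by ring.
have st' : s < t by rewrite lt_neqAle nst.
set m := p * s + (1 - p) * t.
have sm : s <= m by rewrite /m; nra.
have mt : m <= t by rewrite /m; nra.
pose x u := expR (- (b * u)).
have xts : x t < x s by rewrite ltr_expR ltrN2 ltr_pM2l.
pose beta := (S t - S s) / (x t - x s).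
pose alpha := S s - beta * x s.
have xts0 : x t - x s != 0 by rewrite lt_eqF// subr_lt0.
have ls : alpha + beta * x s = S s by rewrite /alpha; ring.
have lt : alpha + beta * x t = S t by rewrite /alpha /beta; field.
have beta0 : beta <= 0.
  have := rigid_nondecreasing s t s0 st tD => Sst.
  by rewrite /beta mulr_ge0_le0 ?subr_ge0// invr_le0 subr_le0 ltW.
have xm : x m <= p * x s + (1 - p) * x t.
  (* [x] lies above its tangent at [m]; averaging the tangent values at [s] and [t] gives back
     [x m]. *)
  have tangent u : x m * (1 - b * (u - m)) <= x u.
    have -> : x u = x m * expR (- (b * (u - m))).
      by rewrite -expRD; congr expR; ring.
    by rewrite ler_wpM2l ?expR_ge0//; have := @expR_ge1Dx R (- (b * (u - m))).
  have -> : x m = p * (x m * (1 - b * (s - m))) + (1 - p) * (x m * (1 - b * (t - m))).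
    by rewrite [in RHS]/m; ring.
  by rewrite lerD// ler_wpM2l// subr_ge0.
have := rigid_above_chord alpha beta s m t s0 sm mt tD.
rewrite -!/(x _) ls lt => /(_ (lexx _) (lexx _)); apply: le_trans.
have -> : p * S s + (1 - p) * S t = alpha + beta * (p * x s + (1 - p) * x t).
  by rewrite -ls -lt; ring.
by rewrite lerD2l ler_wnM2l.
Qed.

End RigidShape.

(** * Strict concavity of the throughput *)

(** With [y = ln (1 + x) - ln (1 + p)] the gap equals [expR y - 1 - y], which is nonnegative and
    vanishes only at [y = 0]. *)
Lemma ln_tangent_gap (R : realType) (p x : R) : 0 <= p -> 0 <= x ->
  0 <= ln (1 + p) - ln (1 + x) - (1 + p)^-1 * (p - x) /\
  (ln (1 + p) - ln (1 + x) - (1 + p)^-1 * (p - x) = 0 -> x = p).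
Proof.
move=> p0 x0.
have p1 : 0 < 1 + p by lra.
have x1 : 0 < 1 + x by lra.
have zE : expR (ln (1 + x) - ln (1 + p)) = 1 - (1 + p)^-1 * (p - x).
  rewrite expRB !lnK ?posrE//; field; exact: lt0r_neq0.
split; first by have := @expR_ge1Dx R (ln (1 + x) - ln (1 + p)); rewrite zE; lra.
move=> gap0; have [e0|ne0] := eqVneq (ln (1 + x) - ln (1 + p)) 0; last first.
  by have := expR_gt1Dx ne0; rewrite zE; lra.
have : 1 + x = 1 + p by apply: ln_inj; rewrite ?posrE//; lra.
lra.
Qed.

Lemma integrable_of_energy (R : realType) (D E : R) (P : R -> R) :
  power_policy D P -> (energy D P <= E%:E)%E ->
  lebesgue_measure.-integrable `[0, D] (EFin \o P).
Proof.
move=> [mP P0] PE; apply/integrableP; split; first exact/measurable_EFinP.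
apply: le_lt_trans (ltry E); apply: le_trans PE.
rewrite le_eqVlt; apply/orP; left; apply/eqP; apply: eq_integral => x /set_mem xD.
by rewrite /= ger0_norm// P0.
Qed.

Lemma integrable_ln1D (R : realType) (D : R) (P : R -> R) :
  power_policy D P ->
  lebesgue_measure.-integrable `[0, D] (EFin \o P) ->
  lebesgue_measure.-integrable `[0, D] (EFin \o (fun u => ln (1 + P u))).
Proof.
move=> [mP P0] iP.
apply: (le_integrable _ _ _ iP) => //.
  apply/measurable_EFinP; apply: measurableT_comp; first exact: measurable_ln.
  exact: measurable_funD.
move=> x xD; have Px := P0 x xD.
rewrite /= lee_fin !ger0_norm ?ln_ge0//; last by lra.
apply: le_ln1Dx; lra.
Qed.

Lemma throughputE (R : realType) (D : R) (P : R -> R) :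
  power_policy D P ->
  lebesgue_measure.-integrable `[0, D] (EFin \o P) ->
  throughput D P =
    (2^-1 / ln 2 * \int[lebesgue_measure]_(u in `[0, D]) ln (1 + P u))%:E.
Proof.
move=> pP iP; have iln := integrable_ln1D _ _ _ pP iP.
rewrite /throughput -RintegralZl//= /Rintegral fineK.
  by apply: eq_integral => u _; congr EFin; ring.
apply: integrable_fin_num => //.
exact: (@integrableZl _ _ _ lebesgue_measure _ _ (2^-1 / ln 2) _ iln).
Qed.

(** Subtracting the tangent of the logarithm at [p] gives [h], which is 0 where [Q = P] and a
    tangent gap where [Q = p]. The linear term integrates to 0 by equal energy, so the integral of
    [h] is at most 0; hence [h] vanishes almost everywhere and the equality case applies. *)
Lemma ae_eq_of_throughput_le (R : realType) (D p : R) (P Q : R -> R) :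
  0 <= p -> power_policy D P -> power_policy D Q ->
  lebesgue_measure.-integrable `[0, D] (EFin \o P) ->
  lebesgue_measure.-integrable `[0, D] (EFin \o Q) ->
  (forall u, u \in `[0, D] -> Q u = P u \/ Q u = p) ->
  \int[lebesgue_measure]_(u in `[0, D]) Q u =
    \int[lebesgue_measure]_(u in `[0, D]) P u ->
  (throughput D Q <= throughput D P)%E ->
  P = Q %[ae lebesgue_measure in `[0, D]%classic].
Proof.
move=> p0 pP pQ iP iQ QP intQP.
rewrite !throughputE// lee_fin ler_pM2l ?divr_gt0 ?ln_gt0 ?invr_gt0 ?ltr1n// => thr.
have iln1 := integrable_ln1D _ _ _ pP iP.
have iln2 := integrable_ln1D _ _ _ pQ iQ.
have idln := @integrableB _ _ _ lebesgue_measure _ (measurable_itv _) _ _ iln2 iln1.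
have idiff := @integrableB _ _ _ lebesgue_measure _ (measurable_itv _) _ _ iQ iP.
have iZ := @integrableZl _ _ _ lebesgue_measure _ (measurable_itv _) (1 + p)^-1 _ idiff.
pose h u := ln (1 + Q u) - ln (1 + P u) - (1 + p)^-1 * (Q u - P u).
have ih : lebesgue_measure.-integrable `[0, D] (EFin \o h).
  exact: (@integrableB _ _ _ lebesgue_measure _ (measurable_itv _) _ _ idln iZ).
have hgap u : `[0, D]%classic u -> 0 <= h u /\ (h u = 0 -> P u = Q u).
  move=> uD; have [QE|QE] := QP u uD; rewrite /h QE.
    by rewrite !subrr mulr0 subrr.
  by apply: ln_tangent_gap => //; exact: pP.2.
have inth : \int[lebesgue_measure]_(u in `[0, D]) h u = 0.
  apply/eqP; rewrite eq_le Rintegral_ge0 ?andbT; last by move=> u /hgap[].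
  rewrite /h RintegralB// RintegralB// RintegralZl// RintegralB// intQP.
  by rewrite subrr mulr0 subr0 subr_le0.
have mh : measurable_fun `[0, D] (EFin \o h).
  exact: (measurable_int lebesgue_measure).
have [+ _] := @ae_eq_integral_abs _ _ _ lebesgue_measure _ (measurable_itv _) _ mh.
have -> : (\int[lebesgue_measure]_(u in `[0%R, D]) `|(EFin \o h) u|)%E = 0%E.
  transitivity (\int[lebesgue_measure]_(u in `[0%R, D]) (h u)%:E)%E.
    by apply: eq_integral => u /set_mem /hgap [h0 _]; rewrite /= ger0_norm.
  rewrite -[LHS]fineK; last exact: integrable_fin_num.
  by congr EFin.
move=> /(_ erefl); apply: filterS => u hu uD.
by apply: (hgap u uD).2; have [] := hu uD.
Qed.

(** * Averaging a policy over a subinterval *)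

(* The interval is open at [s] so that integrals up to [s] are literally unchanged. *)
Definition averaged {R : realType} (s t p : R) (P : R -> R) (u : R) : R :=
  if (s < u) && (u <= t) then p else P u.

Lemma measurable_averaged (R : realType) (D s t p : R) (P : R -> R) :
  measurable_fun `[0, D] P -> measurable_fun `[0, D] (averaged s t p P).
Proof.
move=> mP; apply: measurable_fun_if => //.
- have -> : (fun u : R => (s < u) && (u <= t)) = (fun u => u \in `]s, t]).
    by apply/funext => u; rewrite in_itv.
  apply: (measurable_fun_bool true) => //.
  rewrite (_ : _ @^-1` _ = `]s, t]%classic)//.
  exact: measurableI.
- by apply: measurable_funS mP => //; exact: subIsetl.
Qed.

Section WeightedAverage.
Context (R : realType) (D s t p : R) (w P : R -> R).
Context (s0 : 0 <= s) (st : s <= t) (tD : t <= D).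
Let Q := averaged s t p P.
Let mu := @lebesgue_measure R.
Context (mw : measurable_fun `[0, D] w) (mP : measurable_fun `[0, D] P).
Context (iw : mu.-integrable `[0, D] (EFin \o w)).
Context (iwP : mu.-integrable `[0, D] (EFin \o (fun u => w u * P u))).

(** The weight [w] will be 1 for energy and [a * expR (b * u)] for temperature. The integrand is
    dominated by [|p * w| + |w * P|]. *)
Lemma integrable_averaged :
  mu.-integrable `[0, D] (EFin \o (fun u => w u * Q u)).
Proof.
have ipw := @integrableZl _ _ _ mu _ (measurable_itv _) p _ iw.
have iabs := @integrableD _ _ _ mu _ (measurable_itv _) _ _ (integrable_abse ipw) (integrable_abse iwP).
apply: (le_integrable _ _ _ iabs) => //.
  apply/measurable_EFinP; apply: measurable_funM => //.
  exact: measurable_averaged.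
move=> u uD; rewrite /= !lee_fin /Q /averaged [leRHS]ger0_norm ?addr_ge0//.
case: ifP => _; rewrite !normrM ?[`|w u| * `|p|]mulrC.
  by rewrite lerDl -normrM.
by rewrite lerDr -normrM.
Qed.

Let sub_integrable (f : R -> R) x y : 0 <= x -> y <= D ->
  mu.-integrable `[0, D] (EFin \o f) -> mu.-integrable `[x, y] (EFin \o f).
Proof.
move=> x0 yD; apply: integrableS => //.
by apply: subset_itv; rewrite bnd_simp.
Qed.

Let Rintegral_split (f : R -> R) x y : 0 <= x -> x <= y -> y <= D ->
  mu.-integrable `[0, D] (EFin \o f) ->
  \int[mu]_(u in `[0, y]) f u =
    \int[mu]_(u in `[0, x]) f u + \int[mu]_(u in `]x, y]) f u.
Proof.
move=> x0 xy yD iF; rewrite -(@Rintegral_itvB _ f (BLeft 0)) ?subrKC ?bnd_simp//.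
exact: sub_integrable.
Qed.

Lemma Rintegral_averaged_before x : x <= s ->
  \int[mu]_(u in `[0, x]) (w u * Q u) = \int[mu]_(u in `[0, x]) (w u * P u).
Proof.
move=> xs; apply: eq_Rintegral => u; rewrite inE/= in_itv/= => /andP[_ ux].
by rewrite /Q /averaged ltNge (le_trans ux xs).
Qed.

Lemma Rintegral_averaged_inside x : s <= x -> x <= t ->
  \int[mu]_(u in `[0, x]) (w u * Q u) = \int[mu]_(u in `[0, s]) (w u * P u)
    + p * (\int[mu]_(u in `[0, x]) w u - \int[mu]_(u in `[0, s]) w u).
Proof.
move=> sx xt; have xD := le_trans xt tD.
rewrite (Rintegral_split _ _ _ s0 sx xD integrable_averaged) Rintegral_averaged_before//.
rewrite (Rintegral_split _ _ _ s0 sx xD iw) addrAC subrr add0r; congr (_ + _).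
rewrite -RintegralZl//; last first.
  apply: integrableS (sub_integrable _ _ _ s0 xD iw) => //.
  by apply: subset_itv; rewrite bnd_simp.
apply: eq_Rintegral => u; rewrite inE/= in_itv/= => /andP[su ux].
by rewrite /Q /averaged su (le_trans ux xt) mulrC.
Qed.

Lemma Rintegral_averaged_after x : t <= x -> x <= D ->
  \int[mu]_(u in `[0, x]) (w u * Q u) = \int[mu]_(u in `[0, x]) (w u * P u)
    - (\int[mu]_(u in `[0, t]) (w u * P u) - \int[mu]_(u in `[0, s]) (w u * P u))
    + p * (\int[mu]_(u in `[0, t]) w u - \int[mu]_(u in `[0, s]) w u).
Proof.
move=> tx xD; have t0 := le_trans s0 st.
rewrite (Rintegral_split _ _ _ t0 tx xD integrable_averaged) Rintegral_averaged_inside//.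
rewrite (Rintegral_split _ _ _ t0 tx xD iwP).
rewrite (_ : \int[mu]_(u in `]t, x]) (w u * Q u) =
  \int[mu]_(u in `]t, x]) (w u * P u)); first by ring.
apply: eq_Rintegral => u; rewrite inE/= in_itv/= => /andP[tu ux].
by rewrite /Q /averaged [u <= t]leNgt tu andbF.
Qed.

End WeightedAverage.

(** * Heating integrals and their dependence on the policy *)

Section Heating.
Context (R : realType) (D a b : R) (P : R -> R).
Context (a0 : 0 < a) (b0 : 0 < b).
Let mu := @lebesgue_measure R.

Lemma continuous_scaled_expR : continuous (fun u : R => a * expR (b * u)).
Proof.
move=> x; apply: cvgM; first exact: cvg_cst.
apply: continuous_comp; last exact: continuous_expR.
by apply: cvgM; [exact: cvg_cst|exact: cvg_id].
Qed.

Lemma integrable_scaled_expR x y :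
  mu.-integrable `[x, y] (EFin \o (fun u : R => a * expR (b * u))).
Proof.
apply: continuous_compact_integrable; first exact: segment_compact.
exact: continuous_subspaceT continuous_scaled_expR.
Qed.

Lemma Rintegral_scaled_expR x : 0 <= x ->
  \int[mu]_(u in `[0, x]) (a * expR (b * u)) = a / b * (expR (b * x) - 1).
Proof.
rewrite le_eqVlt => /predU1P[<-|x0].
  by rewrite set_itv1 Rintegral_set1 mulr0 expR0 subrr mulr0.
pose G (u : R) := a / b * expR (b * u).
have dG (u : R) : is_derive u 1 G (a * expR (b * u)).
  apply: is_derive_eq; rewrite /GRing.scale/=; field; exact: lt0r_neq0.
have cG : continuous G.
  by move=> u; apply/differentiable_continuous/derivable1_diffP; case: (dG u).
rewrite /Rintegral (@continuous_FTC2 _ _ G)//=.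
- by rewrite /G mulr0 expR0; ring.
- exact: continuous_subspaceT continuous_scaled_expR.
- split=> [u _||]; first by case: (dG u).
  + exact/cvg_at_right_filter/cG.
  + exact/cvg_at_left_filter/cG.
- by move=> u _; rewrite derive1E; case: (dG u).
Qed.

Lemma integrable_weighted_power :
  (forall t, t \in `[0, D] -> 0 <= P t) ->
  mu.-integrable `[0, D] (EFin \o P) ->
  mu.-integrable `[0, D] (EFin \o (fun u => a * expR (b * u) * P u)).
Proof.
move=> P0 iP.
(* On [[0, D]] the weight is at most its value at [D]. *)
have iZ := @integrableZl _ _ _ mu _ (measurable_itv _) (a * expR (b * D)) _ iP.
apply: (le_integrable _ _ _ iZ) => //.
  apply/measurable_EFinP; apply: measurable_funM.
    have := continuous_measurable_fun continuous_scaled_expR.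
    exact: measurable_funS.
  by apply/measurable_EFinP; apply: (measurable_int mu).
move=> u uD; have Pu := P0 u uD.
move: uD; rewrite /= in_itv/= => /andP[_ uD].
have e0 x : 0 <= a * expR (b * x) by rewrite mulr_ge0 ?expR_ge0// ltW.
rewrite lee_fin !ger0_norm ?(mulr_ge0 (e0 _))//.
by rewrite ler_wpM2r// ler_pM2l// ler_expR ler_pM2l.
Qed.

End Heating.

Lemma Rintegral_one (R : realType) (x : R) : 0 <= x ->
  \int[lebesgue_measure]_(u in `[0, x]) (1 : R) = x.
Proof.
move=> x0; rewrite Rintegral_cst//= lebesgue_measure_itv/= lte_fin mul1r.
by move: x0; rewrite le_eqVlt => /predU1P[<-|->]; rewrite ?ltxx// -EFinB subr0.
Qed.

(** Integrals ignore null sets; this turns almost everywhere equality of policies into equality of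
    temperatures at every time. *)
Lemma eq_temperature (R : realType) (D a b Te : R) (P Q : R -> R) (t : R) :
  measurable_fun `[0, D] P -> measurable_fun `[0, D] Q ->
  P = Q %[ae lebesgue_measure in `[0, D]%classic] -> t <= D ->
  temperature a b Te P t = temperature a b Te Q t.
Proof.
move=> mP mQ PQ tD; rewrite /temperature; congr (_ + _ * fine _).
have tsub : `[0, t]%classic `<=` `[0, D]%classic.
  by apply: subset_itv; rewrite bnd_simp.
have mw f : measurable_fun `[0, D] f ->
    measurable_fun `[0, t] (EFin \o (fun u => a * expR (b * u) * f u)).
  move=> mf; apply/measurable_EFinP; apply: measurable_funM.
    have := continuous_measurable_fun (continuous_scaled_expR R a b).
    exact: measurable_funS.
  exact: measurable_funS mf.
apply: ae_eq_integral => //; [exact: mw|exact: mw|].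
have [N [mN N0 sN]] := PQ; exists N; split=> // u /= hu.
by apply: sN => /= PQu; apply: hu => /tsub /PQu /= ->.
Qed.

(** * Optimal policies are rigid under averaging *)

Lemma optimal_rigid (R : realType) (D E a b Te Tc : R) (P : R -> R) :
  0 < D -> 0 < a -> 0 < b -> optimal_policy D E a b Te Tc P ->
  rigid_under_averaging R a b D (Tc - Te)
    (fun t => temperature a b Te P t - Te)
    (fun t => \int[lebesgue_measure]_(u in `[0, t]) P u).
Proof.
move=> D0 a0 b0 [[pP TP EP] opt].
have [mP P0] := pP.
have iP := integrable_of_energy _ _ _ _ pP EP.
have iwP := integrable_weighted_power R D a b P a0 b0 P0 iP.
pose y t := \int[lebesgue_measure]_(u in `[0, t]) (a * expR (b * u) * P u).
pose F t := \int[lebesgue_measure]_(u in `[0, t]) P u.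
have TE Q t : temperature a b Te Q t - Te = expR (- (b * t)) *
    \int[lebesgue_measure]_(u in `[0, t]) (a * expR (b * u) * Q u).
  by rewrite /temperature addrAC subrr add0r.
have sub f x z : 0 <= x -> z <= D ->
    lebesgue_measure.-integrable `[0, D] (EFin \o f) ->
    lebesgue_measure.-integrable `]x, z] (EFin \o f).
  move=> x0 zD; apply: integrableS => //.
  by apply: subset_itv; rewrite bnd_simp.
have diff f x z : 0 <= x -> x <= z -> z <= D ->
    lebesgue_measure.-integrable `[0, D] (EFin \o f) ->
    \int[lebesgue_measure]_(u in `[0, z]) f u
      - \int[lebesgue_measure]_(u in `[0, x]) f u =
    \int[lebesgue_measure]_(u in `]x, z]) f u.
  move=> x0 xz zD iF; rewrite (@Rintegral_itvB _ f (BLeft 0)) ?bnd_simp//.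
  by apply: integrableS iF => //; apply: subset_itv; rewrite bnd_simp.
have F_homo x z : 0 <= x -> x <= z -> z <= D -> F x <= F z.
  move=> x0 xz zD; rewrite -subr_ge0 (diff P)//.
  apply: Rintegral_ge0 => u; rewrite /= in_itv/= => /andP[xu uz].
  by apply: P0; rewrite in_itv/= (le_trans x0 (ltW xu)) (le_trans uz).
split.
- by rewrite TE set_itv1 Rintegral_set1 mulr0.
- move=> t t0 tD; rewrite TE mulr_ge0 ?expR_ge0//.
  apply: Rintegral_ge0 => u; rewrite /= in_itv/= => /andP[u0 ut].
  rewrite mulr_ge0 ?P0 ?in_itv/= ?u0 ?(le_trans ut)//.
  by rewrite mulr_ge0 ?expR_ge0// ltW.
- by move=> t t0 tD; rewrite lerB// TP// in_itv/= t0.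
- have -> : (fun t => temperature a b Te P t - Te) =
      (fun t => expR (- (b * t)) * y t).
    by apply/funext => t; rewrite TE.
  have cy := parameterized_integral_continuous (ltW D0) iwP.
  have ce : {within `[0, D], continuous (fun t : R => expR (- (b * t)))}.
    apply: continuous_subspaceT => t.
    apply: continuous_comp; last exact: continuous_expR.
    by apply: cvgN; apply: cvgM; [exact: cvg_cst|exact: cvg_id].
  by move=> t; apply: cvgM; [exact: ce|exact: cy].
- exact: parameterized_integral_continuous (ltW D0) iP.
(* The right side is [expR (- (b * s))] times the integral of [a * expR (b * u) * P u] over []s,
   t]], where [expR (b * s) <= expR (b * u)]. *)
- move=> s t s0 st tD; rewrite !TE -/(y s) -/(y t).
  rewrite mulrA -expRD.
  have -> : b * (t - s) + - (b * t) = - (b * s) by ring.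
  rewrite -mulrBr (diff _ s t s0 st tD iP) (diff _ s t s0 st tD iwP).
  rewrite -(ler_pM2l (expR_gt0 (b * s))) mulrA [leRHS]mulrA.
  rewrite expRxMexpNx_1 mul1r [expR _ * a]mulrC.
  rewrite -RintegralZl//; last exact: sub.
  apply: le_Rintegral => //; [|exact: sub|].
    exact: (@integrableZl _ _ _ lebesgue_measure _ _ _ _ (sub _ _ _ s0 tD iP)).
  move=> u; rewrite /= in_itv/= => /andP[su ut].
  rewrite ler_wpM2r//; last by rewrite ler_pM2l// ler_expR ler_pM2l// ltW.
  by apply: P0; rewrite in_itv/= (le_trans s0 (ltW su)) (le_trans ut).
- move=> s t s0 st tD; rewrite -/(F t) -/(F s).
  set p := (F t - F s) / (t - s) => c U Ut tS.
  have p0 : 0 <= p.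
    by rewrite divr_ge0 ?subr_ge0 ?(ltW st)// F_homo// ltW.
  have ts0 : t - s != 0 by rewrite gt_eqF// subr_gt0.
  have st' := ltW st.
  (* [Q] is the competitor. Once feasible, it cannot beat [P], so it equals [P] almost everywhere
     and has the same temperature. *)
  pose Q := averaged s t p P.
  have mQ : measurable_fun `[0, D] Q by exact: measurable_averaged.
  have QP u : u \in `[0, D] -> Q u = P u \/ Q u = p.
    by move=> _; rewrite /Q /averaged; case: ifP; [right|left].
  have pQ : power_policy D Q.
    by split=> // u uD; have [->|->] := QP u uD; rewrite ?P0.
  have i1 : lebesgue_measure.-integrable `[0, D] (EFin \o (fun _ : R => (1 : R))).
    apply: continuous_compact_integrable; first exact: segment_compact.
    by apply: continuous_subspaceT => x; exact: cvg_cst.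
  have mul1 f : (fun u : R => 1 * f u) = f.
    by apply/funext => u; rewrite mul1r.
  have i1P : lebesgue_measure.-integrable `[0, D] (EFin \o (fun u => 1 * P u)).
    by rewrite mul1.
  have iQ : lebesgue_measure.-integrable `[0, D] (EFin \o Q).
    have := integrable_averaged R D s t p (fun=> 1) P (measurable_cst _) mP i1 i1P.
    by rewrite mul1.
  have intQ : \int[lebesgue_measure]_(u in `[0, D]) Q u =
      \int[lebesgue_measure]_(u in `[0, D]) P u.
    have := Rintegral_averaged_after R D s t p (fun=> 1) P s0 st' tD
      (measurable_cst _) mP i1 i1P D tD (lexx _).
    rewrite !mul1 => ->; rewrite !Rintegral_one ?(le_trans s0)//.
    by rewrite -/(F t) -/(F s) /p divfK// addrNK.
  have mw : measurable_fun `[0, D] (fun u : R => a * expR (b * u)).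
    have := continuous_measurable_fun (continuous_scaled_expR R a b).
    exact: measurable_funS.
  have iw := integrable_scaled_expR R a b 0 D.
  have before x : x <= s ->
      temperature a b Te Q x - Te = temperature a b Te P x - Te.
    by move=> xs; rewrite !TE Rintegral_averaged_before.
  have inside x : s <= x -> x <= t -> temperature a b Te Q x - Te = U x.
    move=> sx xt; rewrite !TE.
    rewrite (Rintegral_averaged_inside R D s t p _ P s0 tD mw mP iw iwP)//.
    rewrite !Rintegral_scaled_expR ?(le_trans s0)// /U TE -/(y s) /c.
    have -> : expR (- (b * (x - s))) = expR (- (b * x)) * expR (b * s).
      by rewrite -expRD; congr expR; ring.
    have exE := expRxMexpNx_1 (b * x); have esE := expRxMexpNx_1 (b * s).
    rewrite mulrDr.
    have -> : expR (- (b * x)) * y s =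
        expR (- (b * s)) * y s * (expR (- (b * x)) * expR (b * s)).
      by rewrite -[LHS]mul1r -esE; ring.
    have -> : expR (- (b * x)) * (p * (a / b * (expR (b * x) - 1)
          - a / b * (expR (b * s) - 1))) =
        a * p / b * (expR (b * x) * expR (- (b * x))
          - expR (- (b * x)) * expR (b * s)) by ring.
    by rewrite exE; ring.
  (* Past [t] the temperature change made at [t] only decays, so its sign at [t] decides
     feasibility. *)
  have after x : t <= x -> x <= D -> temperature a b Te Q x - Te =
      temperature a b Te P x - Te
        + expR (- (b * (x - t))) * (U t - (temperature a b Te P t - Te)).
    move=> tx xD; rewrite -(inside t st' (lexx _)) !TE -mulrBr mulrA -expRD.
    have -> : - (b * (x - t)) + - (b * t) = - (b * x) by ring.
    rewrite (Rintegral_averaged_after R D s t p _ P s0 st' tD mw mP iw iwP x tx xD).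
    rewrite (Rintegral_averaged_inside R D s t p _ P s0 tD mw mP iw iwP)//.
    by ring.
  have TQ x : x \in `[0, D] -> temperature a b Te Q x <= Tc.
    rewrite in_itv/= => /andP[x0 xD]; rewrite -(lerD2r (- Te)).
    have TPx : temperature a b Te P x - Te <= Tc - Te.
      by rewrite lerB// TP// in_itv/= x0.
    have [xs|sx] := leP x s; first by rewrite before.
    have [xt|tx] := leP x t.
      rewrite inside ?(ltW sx)//.
      have TPs : temperature a b Te P s - Te <= Tc - Te.
        by rewrite lerB// TP// in_itv/= s0 (le_trans st').
      (* [U] moves monotonically from [S s] towards [c]. If [c] is admissible, so is every convex
         combination; otherwise [U] increases and stays below the admissible [U t]. *)
      have [cT|Tcc] := leP c (Tc - Te).
        have e1 : expR (- (b * (x - s))) <= 1.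
          by rewrite expR_le1 oppr_le0 mulr_ge0 ?subr_ge0// ltW.
        have := @expR_gt0 R (- (b * (x - s))).
        rewrite /U; nra.
      apply: le_trans Ut.
      have : expR (- (b * (t - s))) <= expR (- (b * (x - s))).
        by rewrite ler_expR lerN2 ler_pM2l// lerD2r.
      rewrite /U; nra.
    rewrite after ?(ltW tx)//.
    case: tS => [tDE|UtS]; first by move: tx; rewrite tDE ltNge xD.
    apply: le_trans TPx; rewrite gerDl mulr_ge0_le0 ?expR_ge0// subr_le0//.
  have EQ : (energy D Q <= E%:E)%E.
    have fE f : lebesgue_measure.-integrable `[0, D] (EFin \o f) ->
        energy D f = (\int[lebesgue_measure]_(u in `[0, D]) f u)%:E.
      by move=> iF; rewrite /energy /Rintegral fineK//; exact: integrable_fin_num.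
    by rewrite fE// intQ -fE.
  have thr := opt Q (And3 pQ TQ EQ).
  have PQ := ae_eq_of_throughput_le R D p P Q p0 pP pQ iP iQ QP intQ thr.
  move=> x sx xt; rewrite -(inside x sx xt).
  by rewrite (eq_temperature R D a b Te P Q x mP mQ PQ (le_trans xt tD)).
Qed.

Theorem lemma16 (R : realType) (D E a b Te Tc : R)
    (hD : 0 < D) (hE : 0 < E) (ha : 0 < a) (hb : 0 < b) (hT : Te < Tc)
    (P : R -> R) (hP : optimal_policy D E a b Te Tc P) :
  {in `[0, D] &, nondecreasing_fun (temperature a b Te P)} /\
  concave_on `[0, D] (temperature a b Te P).
Proof.
have rig := optimal_rigid R D E a b Te Tc P hD ha hb hP.
split=> [s t|].
  rewrite !in_itv/= => /andP[s0 sD] /andP[t0 tD] st.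
  rewrite -(lerD2r (- Te)).
  exact: (rigid_nondecreasing _ _ _ _ _ _ _ hb hD rig s t s0 st tD).
move=> k s t; rewrite !inE/= !in_itv/= => /andP[s0 sD] /andP[t0 tD].
wlog st : k s t s0 sD t0 tD / s <= t => [wl|].
  have [st|/ltW ts] := leP s t; first exact: wl.
  by rewrite convC [leRHS]convC; exact: wl.
have k0 : 0 <= k%:num by [].
have k1 : k%:num <= 1 by exact: le1.
(* The offset [Te] cancels because the two convex weights sum to 1. *)
have := rigid_concave _ _ _ _ _ _ _ hb hD rig s t k%:num s0 st tD k0 k1.
rewrite /= !convRE /unstable.onem. lra.
Qed.
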